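(* Let $(X,\tau,\mathfrak{a})$ be an $\mathfrak{a}$-$T_2$ space and let $A\subseteq X$. If $A$ is $\mathfrak{a}$-compact, then $A$ is $\mathfrak{a}$-closed.
   Context: An aura topological space (or $\mathfrak{a}$-space) $(X,\tau,\mathfrak{a})$ is a topological space $(X,\tau)$ together with a function $\mathfrak{a}:X\to\tau$ (a scope function) such that $x\in\mathfrak{a}(x)$ for every $x\in X$. A subset $A\subseteq X$ is $\mathfrak{a}$-open if $\mathfrak{a}(x)\subseteq A$ for every $x\in A$; the collection $\tau_{\mathfrak{a}}$ of all $\mathfrak{a}$-open sets is a topology on $X$ with $\tau_{\mathfrak{a}}\subseteq\tau$. A subset $F\subseteq X$ is $\mathfrak{a}$-closed if $X\setminus F\in\tau_{\mathfrak{a}}$. A subset $A\subseteq X$ is $\mathfrak{a}$-compact if every cover of $A$ by members of $\tau_{\mathfrak{a}}$ has a finite subcover. The space is $\mathfrak{a}$-$T_2$ if for each pair of distinct points $x\neq y$ of $X$ there exist disjoint $\mathfrak{a}$-open sets $U,V$ with $x\in U$ and $y\in V$. *)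

(* Defs.v *)
From mathcomp Require Import all_boot all_order all_classical topology.

Set Implicit Arguments.
Unset Strict Implicit.
Unset Printing Implicit Defensive.

Local Open Scope classical_set_scope.

Record scope_function (X : topologicalType) := ScopeFunction {
  scope :> X -> set X;
  scope_open : forall x, open (scope x);
  scope_self : forall x, scope x x }.

Section Aura.
Context {X : topologicalType} (a : scope_function X).

(* The topology [tau_a], as a family of subsets of X; [aura_open A] reads
   "A is a-open". The library's [open] remains the original topology [tau]. *)
Definition aura_open : set (set X) :=
  [set A | forall x, A x -> a x `<=` A].

Definition aura_closed (F : set X) : Prop := aura_open (~` F).

Definition aura_compact (A : set X) : Prop :=
  forall C : set (set X), C `<=` aura_open -> A `<=` \bigcup_(U in C) U ->
  exists D : set (set X),
    [/\ D `<=` C, finite_set D & A `<=` \bigcup_(U in D) U].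

Definition aura_T2 : Prop :=
  forall x y : X, x <> y ->
  exists U V : set X,
    [/\ aura_open U, aura_open V, U x, V y & U `&` V = set0].

End Aura.

(* Main.v *)
(* If y <> x were in a(x), an a-open V containing x would contain a(x), hence
   y, so x and y could not be separated. Thus a(x) = {x} for every x: the
   topology tau_a is discrete, and every subset is a-closed. *)
Require Import Defs.
From mathcomp Require Import all_boot all_order all_classical topology.

Local Open Scope classical_set_scope.

Lemma aura_T2_scope_sub1 (X : topologicalType) (a : scope_function X) (x : X) :
  aura_T2 a -> a x `<=` [set x].
Proof.
move=> T2 y axy; apply: contrapT => /= neq_yx.
have [U [V [_ oV Uy Vx UV0]]] := T2 _ _ neq_yx.
(* The contradiction sits at [y] itself: it lies in [U] by choice, and in [V] because [V] is a-open
   and contains [x], so that it contains all of [a x], where [y] lies. *)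
suff : (U `&` V) y by rewrite UV0.
by split=> //; apply: oV Vx _ axy.
Qed.

Theorem theorem3p6 (X : topologicalType) (a : scope_function X)
    (hT2 : aura_T2 a) (A : set X) (hA : aura_compact a A) :
  aura_closed a A.
(* For [x] outside [A], any [y] in [a x] is [x] itself, hence also outside [A]; so the scope of [x]
   stays in the complement. *)
Proof. by move=> x nAx y /(aura_T2_scope_sub1 _ _ _ hT2) ->. Qed.
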